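(* Every POVM $\nu:\mathcal O(X)\to\mathcal B(\mathcal H)$ can be written uniquely as the sum $\nu=\nu_a+\nu_{na}$ of an atomic POVM $\nu_a:\mathcal O(X)\to\mathcal B(\mathcal H)$ and a non-atomic POVM $\nu_{na}:\mathcal O(X)\to\mathcal B(\mathcal H)$.
   Context: $X$ is a locally compact Hausdorff space with Borel $\sigma$-algebra $\mathcal O(X)$; $\mathcal H$ is a separable Hilbert space. A POVM $\nu:\mathcal O(X)\to\mathcal B(\mathcal H)$ is a map with positive operator values that is countably additive on pairwise disjoint countable families, with convergence in the ultraweak topology. An atom of $\nu$ is a set $A\in\mathcal O(X)$ with $\nu(A)\neq 0$ such that every measurable $B\subseteq A$ satisfies $\nu(B)=0$ or $\nu(B)=\nu(A)$. $\nu$ is atomic if every measurable set $E$ with $\nu(E)\ne 0$ contains an atom, and non-atomic if it has no atoms (so the zero POVM is both). *)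

(* Defs.v *)
From HB Require Import structures.
From mathcomp Require Import all_boot all_order all_algebra.
From mathcomp Require Import complex.
From mathcomp Require Import all_classical all_reals all_analysis.

Set Implicit Arguments.
Unset Strict Implicit.
Unset Printing Implicit Defensive.

Import Order.TTheory GRing.Theory Num.Theory.
Import numFieldNormedType.Exports.

Local Open Scope classical_set_scope.
Local Open Scope ring_scope.
Local Open Scope complex_scope.

(* Complex Hilbert space, over the complex numbers R[i] of a real type R. The
   inner product is linear in its first argument and induces the norm. *)
Record hilbertSpace (R : realType) := HilbertSpace {
  hilbert_sort :> completeNormedModType R[i];
  inner : {dot hilbert_sort for @Num.conj R[i]};
  inner_norm : forall x : hilbert_sort, inner x x = `|x| ^+ 2 }.

Definition separable (T : topologicalType) :=
  exists D : set T, countable D /\ dense D.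

Section BoundedOperators.
Variables (R : realType) (H : hilbertSpace R).

Definition bounded_linear : {pred H -> H} := [pred T : H -> H |
  `[< linear T /\ exists M : R[i], forall x, `|T x| <= M * `|x| >]].

(* The space B(H). *)
Record boundedOp := BoundedOp {
  boundedOp_fun :> H -> H;
  boundedOpP : boundedOp_fun \in bounded_linear }.

Fact bounded_linear_zmod_closed : zmod_closed bounded_linear.
Proof.
split=> [|S T].
  apply/asboolP; split.
    by move=> a x y; rewrite -[RHS]/(a *: (0 : H) + 0) scaler0 addr0.
  by exists 0 => x; rewrite -[X in `|X|]/(0 : H) normr0 mul0r.
move=> /asboolP[lS [M SM]] /asboolP[lT [N TN]]; apply/asboolP; split.
  move=> a x y; rewrite !fctE lS lT scalerBr opprD.
  by rewrite !addrA; congr (_ + _); rewrite -!addrA; congr (_ + _); rewrite addrC.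
exists (M + N) => x; rewrite !fctE mulrDl.
by rewrite (le_trans (ler_normB _ _))// lerD.
Qed.

HB.instance Definition _ :=
  GRing.isZmodClosed.Build (H -> H) bounded_linear bounded_linear_zmod_closed.
HB.instance Definition _ := [isSub for boundedOp_fun].
HB.instance Definition _ := [Choice of boundedOp by <:].
HB.instance Definition _ := [SubChoice_isSubZmodule of boundedOp by <:].

(* The order of R[i] makes [0 <= z] mean that z is real and nonnegative. *)
Definition positive_op (T : boundedOp) := forall x : H, 0 <= inner H (T x) x.

Record square_summable := SquareSummable {
  square_summable_seq :> nat -> H;
  square_summableP :
    cvgn (series (fun k => `|square_summable_seq k| ^+ 2) : nat -> R[i]^o) }.

HB.instance Definition _ := gen_eqMixin square_summable.
HB.instance Definition _ := gen_choiceMixin square_summable.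

(* Normal functionals on B(H): T |-> \sum_k <T x_k, y_k> for square-summable
   sequences x and y, that is, T |-> tr (T S) with S trace class. *)
Definition normal_functional (T : boundedOp)
    (p : square_summable * square_summable) : R[i]^o :=
  limn (series (fun k => inner H (T (p.1 k)) (p.2 k)) : nat -> R[i]^o).

(* B(H) with the ultraweak topology: the coarsest topology making all the normal
   functionals continuous. *)
Definition ultraweak := initial_topology
  (normal_functional : boundedOp ->
     {ptws (square_summable * square_summable)%type -> R[i]^o}).

End BoundedOperators.

Section POVM.
Variables (R : realType) (X : topologicalType) (H : hilbertSpace R).

Definition borel : set (set X) := <<s @open X >>.

Implicit Types nu : set X -> boundedOp H.

(* Operator-valued set functions are total on [set X]; only their values on
   Borel sets are meaningful. Finite families are covered by sequences padded
   with set0: the constant sequence set0 forces [nu set0 = 0]. *)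
Record is_povm nu : Prop := IsPOVM {
  povm_positive : forall E, borel E -> positive_op (nu E);
  povm_sigma_additive : forall E : nat -> set X,
    (forall i, borel (E i)) -> trivIset [set: nat] E ->
    (fun n => \sum_(i < n) nu (E i) : ultraweak H) @ \oo -->
      (nu (\bigcup_i E i) : ultraweak H) }.

Definition is_atom nu (A : set X) := [/\ borel A, nu A <> 0 &
  forall B, borel B -> B `<=` A -> nu B = 0 \/ nu B = nu A].

Definition atomic nu := forall E, borel E -> nu E <> 0 ->
  exists2 A, A `<=` E & is_atom nu A.

Definition non_atomic nu := forall A, ~ is_atom nu A.

Definition eq_on_borel nu mu := forall E, borel E -> nu E = mu E.

(* nu = nua + nuna, with nua an atomic and nuna a non-atomic POVM. *)
Definition atomic_decomposition nu nua nuna :=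
  [/\ is_povm nua /\ atomic nua, is_povm nuna /\ non_atomic nuna &
      eq_on_borel nu (fun E => nua E + nuna E)].

End POVM.

(* Main.v *)
Require Import Defs.
From HB Require Import structures.
From mathcomp Require Import all_boot all_order all_algebra.
From mathcomp Require Import complex.
From mathcomp Require Import all_classical all_reals all_analysis.
From mathcomp Require Import ring.

(** Atoms are a measure-theoretic notion: they only see which Borel sets are
    null. The one thing that has to be extracted from the operators is
    therefore a good theory of null sets, and it comes from the quadratic forms
    q_T(x) = <T x, x>. For each vector x, E |-> <nu(E) x, x> is a finite
    positive measure, because q is continuous for the ultraweak topology
    ([ultraweak_qform]); an operator is determined by its quadratic form
    ([qform_inj]), and a positive operator vanishes as soon as its form does on
    a dense set ([qform_dense_eq0]).

    The workhorse is an exhaustion principle ([povm_exhaustion]): a class of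
    Borel sets closed under countable unions has a member M that absorbs every
    other member up to a null set. For one vector this is the usual argument
    that a supremum of measures is attained; separability reduces the general
    case to countably many vectors.

    Existence. Let M be an exhausting member of the class of sets all of whose
    non-null parts contain atoms. Then nu restricted to M is atomic. An atom of
    the restriction of nu to the complement of M would yield an atom of nu
    disjoint from M; this atom belongs to the class, hence is null, which is
    absurd.

    Uniqueness. An atomic POVM mu and a non-atomic POVM nu live on
    complementary Borel sets ([atomic_non_atomic_singular]). The reason is that
    every atom A of mu contains a nu-null set of positive mu-measure: remove
    from A an exhausting mu-null part of A with respect to nu; if the remainder
    were not nu-null, then, not being an atom of nu, it could be cut into two
    pieces that are not nu-null, one of which is mu-null and should have been
    removed. So in a decomposition the atomic part is the restriction of the
    given POVM to a Borel set S. If another decomposition gives S', then on the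
    difference of S and S' the POVM equals both the atomic part of the first and
    the non-atomic part of the second, so this difference is null
    ([null_mixed]). *)

Local Open Scope classical_set_scope.
Local Open Scope ring_scope.

(** * Quadratic forms of bounded operators *)

Section QuadraticForm.
Set Implicit Arguments.
Unset Strict Implicit.
Import Order.TTheory GRing.Theory Num.Theory numFieldNormedType.Exports.
Variables (R : realType) (H : hilbertSpace R).
Implicit Types (T S : boundedOp H) (x y : H).

Definition qform T x : R[i] := inner H (T x) x.

Lemma bopD T x y : T (x + y) = T x + T y.
Proof.
have /asboolP[lT _] := boundedOpP T.
by have := lT 1 x y; rewrite !scale1r.
Qed.

Lemma bop0 T : T 0 = 0.
Proof. by apply: (addrI (T 0)); rewrite -bopD !addr0. Qed.

Lemma bopZ T (a : R[i]) x : T (a *: x) = a *: T x.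
Proof.
have /asboolP[lT _] := boundedOpP T.
by have := lT a x 0; rewrite !addr0 bop0 addr0.
Qed.

Lemma bopN T x : T (- x) = - T x.
Proof. by rewrite -scaleN1r bopZ scaleN1r. Qed.

Lemma bop_bounded T : exists2 M : R[i], 0 <= M & forall x, `|T x| <= M * `|x|.
Proof.
have /asboolP[_ [M TM]] := boundedOpP T.
exists `|M| => // x; have Mx0 := le_trans (normr_ge0 _) (TM x).
by rewrite -[`|x|]normr_id -normrM (ger0_norm Mx0).
Qed.

Lemma bopP T S : (forall x, T x = S x) -> T = S.
Proof. by move=> TS; apply: val_inj; apply/funext. Qed.

Lemma innerDl x y z : inner H (x + y) z = inner H x z + inner H y z.
Proof. exact: linearDl. Qed.
Lemma innerDr x y z : inner H z (x + y) = inner H z x + inner H z y.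
Proof. exact: linearDr. Qed.
Lemma innerZl (a : R[i]) x z : inner H (a *: x) z = a * inner H x z.
Proof. exact: linearZl_LR. Qed.
Lemma innerZr (a : R[i]) x z : inner H z (a *: x) = a^* * inner H z x.
Proof. exact: linearZr_LR. Qed.

Lemma innerNl x z : inner H (- x) z = - inner H x z.
Proof. exact: linearNl. Qed.
Lemma innerNr x z : inner H z (- x) = - inner H z x.
Proof. exact: linearNr. Qed.

Lemma qform0 x : qform 0 x = 0.
Proof. exact: linear0l. Qed.

Lemma qformD T S x : qform (T + S) x = qform T x + qform S x.
Proof. exact: innerDl. Qed.

Lemma qform_sum n (T : 'I_n -> boundedOp H) x :
  qform (\sum_(i < n) T i) x = \sum_(i < n) qform (T i) x.
Proof. by apply: (big_morph (qform^~ x)) => [? ?|]; rewrite (qformD, qform0). Qed.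

Lemma qform_addZ T x y (a : R[i]) : qform T (x + a *: y) =
  qform T x + `|a| ^+ 2 * qform T y
  + (a^* * inner H (T x) y + a * inner H (T y) x).
Proof.
rewrite /qform bopD bopZ !(innerDl, innerDr, innerZl, innerZr) normCK.
ring.
Qed.

(** Polarization, which needs complex scalars: expanding q at x + y and at
    x + iy gives <T x, y> + <T y, x> = 0 and <T x, y> - <T y, x> = 0; then take
    y = T x. *)
Lemma qform_eq0 T : (forall x, qform T x = 0) -> T = 0.
Proof.
move=> q0; apply: bopP => x; apply/eqP.
rewrite -[_ == _](dnorm_eq0 (inner H)) /=.
set y := T x.
have := qform_addZ T x y 1; have := qform_addZ T x y 'i.
rewrite !q0 !mulr0 !addr0 !add0r conjC1 !mul1r conjCi mulNr.
rewrite addrC => /esym/subr0_eq/(mulfI (neq0Ci _)) <- /esym/eqP.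
by rewrite -mulr2n mulrn_eq0.
Qed.

Lemma qform_parallelogram T x y :
  qform T (x + y) + qform T (x - y) = (qform T x + qform T y) *+ 2.
Proof.
rewrite /qform !bopD bopN !(innerDl, innerDr, innerNl, innerNr).
ring.
Qed.

Lemma qform_inj T S : (forall x, qform T x = qform S x) -> T = S.
Proof.
move=> TS; apply: subr0_eq; apply: qform_eq0 => x.
by apply: (addIr (qform S x)); rewrite -qformD subrK add0r.
Qed.

(** From 0 <= |T x - x|^2 and the reality of q(x) one gets
    2 q(x) <= |T x|^2 + |x|^2, and T is bounded. *)
Lemma qform_le T : positive_op T ->
  exists2 K : R[i], 0 < K & forall x, qform T x <= K * `|x| ^+ 2.
Proof.
move=> Tpos; have [M M0 TM] := bop_bounded T.
have M1 : 0 < M ^+ 2 + 1 by rewrite ltr_wpDl ?exprn_ge0.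
exists (M ^+ 2 + 1) => // x.
have q0 : 0 <= qform T x by exact: Tpos.
have := dnorm_ge0 (inner H) (T x - x).
rewrite /= dnormB /= !inner_norm -/(qform T x) (geC0_conj q0) subr_ge0.
move=> le2q; apply: le_trans (_ : qform T x + qform T x <= _).
  by rewrite lerDl.
apply: (le_trans le2q); rewrite mulrDl mul1r lerD2r -exprMn.
by rewrite lerXn2r ?nnegrE ?mulr_ge0.
Qed.

(** The parallelogram law and the quadratic bound give
    q(x) <= 2 q(d) + 2 q(x - d) <= 2 K |x - d|^2 for d in D, and x - d can be
    made as small as desired. *)
Lemma qform_dense_eq0 T (D : set H) : dense D -> positive_op T ->
  (forall d, D d -> qform T d = 0) -> T = 0.
Proof.
move=> dD Tpos TD; apply: qform_eq0 => x.
have [K K0 TK] := qform_le Tpos.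
have q0 : forall y, 0 <= qform T y by exact: Tpos.
apply/eqP; rewrite eq_le q0 andbT; apply: contraT => nq.
have qx0 : 0 < qform T x.
  by rewrite lt_neqAle q0 andbT; apply: contra nq => /eqP <-.
pose K2 := K *+ 2; have K20 : 0 < K2 by rewrite mulrn_wgt0.
(* with this radius, e < 1 and 2 K e^2 <= 2 K e < q(x) *)
pose e := qform T x / (K2 + qform T x).
have Kq : 0 < K2 + qform T x by rewrite addr_gt0.
have e0 : 0 < e by rewrite divr_gt0.
have e1 : e < 1 by rewrite ltr_pdivrMr // mul1r ltrDr.
have [d [xd Dd]] : (ball x e) `&` D !=set0.
  by apply: dD; [exists x; exact: ballxx|exact: ball_open].
have {}xd : `|x - d| < e by rewrite -ball_normE in xd.
(* q(x) <= 2 q(d) + 2 q(x - d) by the parallelogram law, and q(d) = 0 *)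
have qxd : qform T x <= qform T (x - d) *+ 2.
  have := qform_parallelogram T (x - d) d.
  by rewrite subrK (TD _ Dd) addr0 => <-; rewrite lerDl.
have : qform T x < qform T x; last by rewrite ltxx.
apply: (le_lt_trans qxd).
apply: (@le_lt_trans _ _ (K2 * e)).
  rewrite /K2 mulrnAl lerMn2r /=; apply: (le_trans (TK _)).
  rewrite ler_pM2l // expr2 -[e]mul1r ler_pM // ltW //.
  exact: lt_trans e1.
rewrite /e mulrA ltr_pdivrMr // mulrC ltr_pM2l //.
by rewrite ltrDl.
Qed.

(** Positivity excludes cancellation; this makes null sets hereditary. *)
Lemma positive_add_eq0 T S : positive_op T -> positive_op S ->
  T + S = 0 -> T = 0.
Proof.
move=> Tpos Spos TS0; apply: qform_eq0 => x.
have : qform (T + S) x = 0 by rewrite TS0 qform0.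
move=> /eqP; rewrite qformD paddr_eq0; [|exact: Tpos|exact: Spos].
by case/andP => /eqP.
Qed.

Definition single x : nat -> H := fun k => if k is 0 then x else 0.

Lemma series_single (f : nat -> R[i]^o) : (forall k, f k.+1 = 0) ->
  series f @ \oo --> f 0%N.
Proof.
move=> f0; apply: cvg_near_cst; exists 1%N => // n /= n1.
rewrite /series /= big_ltn // big_nat_cond big1 ?addr0 // => i.
by rewrite andbT; case: i => [//|i] _; exact: f0.
Qed.

Fact single_summable x : cvgn (series (fun k => `|single x k| ^+ 2) : nat -> R[i]^o).
Proof.
apply/cvg_ex; exists (`|x| ^+ 2).
by apply: (@series_single (fun k => `|single x k| ^+ 2)) => k /=; rewrite normr0 expr0n.
Qed.

Definition single_square_summable x := SquareSummable (@single_summable x).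

Lemma normal_functional_single T x :
  normal_functional T (single_square_summable x, single_square_summable x) =
  qform T x.
Proof.
apply: cvg_lim => //.
apply: (@series_single (fun k => inner H (T (single x k)) (single x k))) => k /=.
by rewrite bop0; exact: linear0l.
Qed.

(** The vector functional T |-> <T x, x> is the normal functional given by the
    sequence (x, 0, 0, ...), taken twice. *)
Lemma ultraweak_qform (F : set_system (boundedOp H)) (T : boundedOp H) x : Filter F ->
  F --> (T : ultraweak H) ->
  (fun S => qform S x : R[i]^o) @ F --> (qform T x : R[i]^o).
Proof.
move=> FF FT.
rewrite -(normal_functional_single T x); under eq_fun do rewrite -normal_functional_single.
have c := @initial_continuous _ _ (@normal_functional R H :
  _ -> {ptws (square_summable H * square_summable H)%type -> R[i]^o}) T.
have := cvg_comp _ _ (cvg_comp _ _ FT c)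
  (@proj_continuous _ (fun=> R[i]^o)
     (single_square_summable x, single_square_summable x) _).
by [].
Qed.

End QuadraticForm.

(** * Finite additivity of POVMs *)

Section Borel.
Set Implicit Arguments.
Unset Strict Implicit.
Import Order.TTheory GRing.Theory Num.Theory numFieldNormedType.Exports.
Variables (X : topologicalType).
Implicit Types E F : set X.

Lemma borel0 : borel (@set0 X).
Proof. by have [] := smallest_sigma_algebra [set: X] open. Qed.

Lemma borelC E : borel E -> borel (~` E).
Proof.
by have [_ bD _] := smallest_sigma_algebra [set: X] open; rewrite -setTD; exact: bD.
Qed.

Lemma borelT : borel [set: X].
Proof. by rewrite -setC0; apply: borelC; exact: borel0. Qed.

Lemma borel_bigcup (E : nat -> set X) :
  (forall i, borel (E i)) -> borel (\bigcup_i E i).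
Proof. exact: sigma_algebra_bigcup. Qed.

Lemma borelU E F : borel E -> borel F -> borel (E `|` F).
Proof.
by move=> bE bF; rewrite -bigcup2E; apply: borel_bigcup => -[|[|i]] //=; exact: borel0.
Qed.

Lemma borelI E F : borel E -> borel F -> borel (E `&` F).
Proof.
move=> bE bF; rewrite -[E `&` F]setCK setCI.
by apply: borelC; apply: borelU; exact: borelC.
Qed.

Lemma borelD E F : borel E -> borel F -> borel (E `\` F).
Proof. by move=> bE bF; rewrite setDE; apply: borelI => //; exact: borelC. Qed.

End Borel.

Section Povm.
Set Implicit Arguments.
Unset Strict Implicit.
Import Order.TTheory GRing.Theory Num.Theory numFieldNormedType.Exports.
Variables (R : realType) (X : topologicalType) (H : hilbertSpace R).
Implicit Types (nu mu : set X -> boundedOp H) (E F : set X).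

Lemma povm_restrict nu S : borel S -> is_povm nu -> is_povm (fun E => nu (E `&` S)).
Proof.
move=> bS [pos add]; split=> [E bE|E bE tE]; first by apply: pos; exact: borelI.
rewrite setI_bigcupl; apply: add => [i|]; first exact: borelI.
exact: trivIset_setIr.
Qed.

Lemma eventually_cst_limit (u : nat -> R[i]^o) (a l : R[i]^o) :
  (\forall n \near \oo, u n = a) -> u @ \oo --> l -> l = a.
Proof. by move=> /cvg_near_cst ua ul; exact: norm_cvg_unique ul ua. Qed.

Section OnePovm.
Variables (nu : set X -> boundedOp H) (nuP : is_povm nu).

Lemma povm_cvg (E : nat -> set X) x :
  (forall i, borel (E i)) -> trivIset [set: nat] E ->
  (fun n => \sum_(i < n) qform (nu (E i)) x : R[i]^o) @ \oo -->
    (qform (nu (\bigcup_i E i)) x : R[i]^o).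
Proof.
move=> bE tE; under eq_fun do rewrite -qform_sum.
exact: ultraweak_qform (povm_sigma_additive nuP bE tE).
Qed.

(** The constant sequence of empty sets is disjoint, so the value c of
    <nu x, x> at the empty set satisfies n c --> c; the increments of this
    sequence tend to 0 and equal c. *)
Lemma povm0 : nu set0 = 0.
Proof.
apply: qform_eq0 => x; set c := qform _ x.
have t0 : trivIset [set: nat] (fun=> @set0 X).
  by apply/trivIsetP => *; rewrite setI0.
have := @povm_cvg _ x (fun=> @borel0 X) t0; rewrite bigcup0 // -/c => uc.
have := cvgB (cvg_comp _ _ (cvg_addnr 1) uc) uc.
rewrite subrr => /(_ _) h; apply/esym/(eventually_cst_limit _ h).
by apply: nearW => n; rewrite !fctE /= !sumr_const !card_ord addn1 mulrS addrK.
Qed.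

Lemma povmU E F : borel E -> borel F -> E `&` F = set0 ->
  nu (E `|` F) = nu E + nu F.
Proof.
move=> bE bF EF0; apply: qform_inj => x.
have bEF i : borel (bigcup2 E F i) by case: i => [|[|i]] //=; exact: borel0.
have tEF : trivIset [set: nat] (bigcup2 E F) by rewrite -trivIset_bigcup2.
have := @povm_cvg _ x bEF tEF; rewrite bigcup2E.
apply: eventually_cst_limit; exists 2%N => // -[|[|n]] // _.
rewrite 2!big_ord_recl /= big1 ?addr0 ?qformD // => i _.
by rewrite /= povm0 qform0.
Qed.

Lemma povmID E F : borel E -> borel F -> nu E = nu (E `&` F) + nu (E `\` F).
Proof.
move=> bE bF; rewrite -povmU ?setUIDK //; [exact: borelI|exact: borelD|].
by rewrite setDE setIACA setICr setI0.
Qed.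

End OnePovm.

End Povm.

(** * Null sets and exhaustion *)

Section Null.
Set Implicit Arguments.
Unset Strict Implicit.
Import Order.TTheory GRing.Theory Num.Theory numFieldNormedType.Exports.
Variables (R : realType) (X : topologicalType) (H : hilbertSpace R).
Implicit Types (nu mu : set X -> boundedOp H) (A B C E F S : set X).

Section OnePovm.
Variables (nu : set X -> boundedOp H) (nuP : is_povm nu).

Lemma povm_sub_null E F : borel E -> borel F -> F `<=` E -> nu E = 0 -> nu F = 0.
Proof.
move=> bE bF FE; rewrite (povmID nuP bE bF) setIidr //.
apply: positive_add_eq0; apply: (povm_positive nuP) => //; exact: borelD.
Qed.

Lemma povm_bigcup_null (E : nat -> set X) : (forall i, borel (E i)) ->
  (forall i, nu (E i) = 0) -> nu (\bigcup_i E i) = 0.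
Proof.
move=> bE E0; rewrite seqDU_bigcup_eq.
have bD i : borel (seqDU E i).
  apply: borelD => //.
  elim: i => [|i ih]; last by rewrite big_ord_recr /=; exact: borelU.
  by rewrite big_ord0; exact: borel0.
apply: qform_eq0 => x.
have := @povm_cvg _ _ _ _ nuP _ x bD (trivIset_seqDU E).
apply: eventually_cst_limit; apply: nearW => n.
rewrite big1 // => i _; rewrite (@povm_sub_null (E i)) ?qform0 //.
exact: subset_seqDU.
Qed.

Lemma povm_eq_diff_null A B : borel A -> borel B -> B `<=` A ->
  nu B = nu A <-> nu (A `\` B) = 0.
Proof.
move=> bA bB BA; rewrite (povmID nuP bA bB) setIidr //; split => [|->].
  by move=> /(congr1 (fun T => T - nu B)); rewrite subrr addrC addKr.
by rewrite addr0.
Qed.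

(** Fix d in a countable dense set. A sequence in P whose d-measures approach
    their supremum over P has a union attaining it, and adding any further
    member C of P cannot increase the measure, so C is d-null outside this
    union. The union over all d then works for every d at once, and density
    turns vanishing of the form on the d's into vanishing of the operator. *)
Lemma povm_exhaustion (P : set (set X)) : separable H ->
  P set0 -> P `<=` @borel X ->
  (forall E : nat -> set X, (forall i, P (E i)) -> P (\bigcup_i E i)) ->
  exists2 M, P M & forall C, P C -> nu (C `\` M) = 0.
Proof.
move=> [D [cD dD]] P0 Pb PU.
pose m d E := complex.Re (qform (nu E) d).
have mre d E : borel E -> (m d E)%:C%C = qform (nu E) d.
  by move=> bE; apply: RRe_real; apply: ger0_real; exact: (povm_positive nuP).
have m0 d E : borel E -> 0 <= m d E.
  by move=> bE; rewrite -(@ler0c R) mre //; exact: (povm_positive nuP).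
have mID d E F : borel E -> borel F -> m d E = m d (E `&` F) + m d (E `\` F).
  by move=> bE bF; rewrite /m (povmID nuP bE bF) qformD raddfD.
have mle d E F : borel E -> borel F -> F `<=` E -> m d F <= m d E.
  by move=> bE bF FE; rewrite (mID d E F) // setIidr // lerDl m0 //; exact: borelD.
have max d : exists2 M, P M & forall C, P C -> m d (C `\` M) = 0.
  pose V := [set m d C | C in P].
  have supV : has_sup V.
    split; first by exists (m d set0), set0.
    exists (m d setT) => _ [C /Pb bC <-]; apply: mle => //; exact: borelT.
  have /choice[C PC] (n : nat) : exists C, P C /\ sup V - n.+1%:R^-1 < m d C.
    have [|_ [C PC <-] lt] := @sup_adherent _ V n.+1%:R^-1 _ supV; last by exists C.
    by rewrite invr_gt0.
  pose M := \bigcup_n C n; have PM : P M by apply: PU => n; have [] := PC n.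
  exists M => // E PE; have bE := Pb _ PE; have bM := Pb _ PM.
  apply/eqP; rewrite eq_le m0 ?andbT; last exact: borelD.
  have supM : sup V <= m d M.
    apply/ler_addgt0Pr => e e0.
    have [n ne] : exists n : nat, n.+1%:R^-1 < e.
      by exists (Num.truncn e^-1); rewrite invf_plt ?posrE // truncnS_gt.
    have [PCn /ltW ltn] := PC n; rewrite -lerBlDr.
    apply: le_trans (mle d M (C n) _ _ _); [|done|exact: Pb|exact: bigcup_sup].
    by apply: le_trans ltn; rewrite lerD2l lerN2 ltW.
  have PME : P (M `|` E).
    rewrite -bigcup2E; apply: PU => -[|[|i]] //=.
  have := sup_upper_bound supV (ex_intro2 _ _ _ PME erefl).
  rewrite (mID d _ M) //; last exact: Pb.
  rewrite setUK setDUl setDv set0U => h.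
  by have := le_trans h supM; rewrite gerDl.
have /pcard_surjP[g Dg] := cD.
have /choice[M PM] n : exists M, P M /\ forall C, P C -> m (g n) (C `\` M) = 0.
  by have [M ? ?] := max (g n); exists M.
pose N := \bigcup_n M n; have PN : P N by apply: PU => n; have [] := PM n.
exists N => // C PC; have bC := Pb _ PC; have bN := Pb _ PN.
have bCN : borel (C `\` N) by exact: borelD.
apply: (qform_dense_eq0 dD); first exact: (povm_positive nuP).
move=> d /Dg[n _ <-]; rewrite -mre //; suff -> : m (g n) (C `\` N) = 0 by [].
have [PMn Mn0] := PM n; have bMn := Pb _ PMn.
apply/eqP; rewrite eq_le m0 // andbT -(Mn0 _ PC); apply: mle => //.
  exact: borelD.
by apply: setDS; exact: bigcup_sup.
Qed.

End OnePovm.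

End Null.

(** * Atomic and non-atomic parts *)

Section Atoms.
Set Implicit Arguments.
Unset Strict Implicit.
Import Order.TTheory GRing.Theory Num.Theory numFieldNormedType.Exports.
Variables (R : realType) (X : topologicalType) (H : hilbertSpace R).
Implicit Types (nu mu : set X -> boundedOp H) (A B C E F S : set X).

Lemma atom_sub nu A B : is_atom nu A -> borel B -> B `<=` A -> nu B <> 0 ->
  is_atom nu B.
Proof.
move=> [bA nA atA] bB BA nB; have [//|BAeq] := atA B bB BA.
by split=> // C bC CB; rewrite BAeq; apply: atA => //; exact: subset_trans BA.
Qed.

Lemma eq_atom nu mu A :
  (forall B, borel B -> B `<=` A -> nu B = mu B) -> is_atom nu A -> is_atom mu A.
Proof.
move=> num [bA nA atA]; split=> // [|B bB BA]; rewrite -!num //.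
exact: atA.
Qed.

Lemma atom_restrict nu S A : borel S ->
  is_atom (fun E => nu (E `&` S)) A -> is_atom nu (A `&` S).
Proof.
move=> bS [bA nA atA]; split=> // [|B bB BAS]; first exact: borelI.
have [BA BS] : B `<=` A /\ B `<=` S by split=> x /BAS[].
by have := atA B bB BA; rewrite (setIidl BS).
Qed.

(** The sets to which the restriction of [nu] is atomic; unlike the countable
    unions of atoms, they are closed under Borel subsets by definition. *)
Definition atomic_set nu E := borel E /\
  forall F, borel F -> F `<=` E -> nu F <> 0 -> exists2 A, A `<=` F & is_atom nu A.

Lemma atomic_set_bigcup nu (E : nat -> set X) : is_povm nu ->
  (forall i, atomic_set nu (E i)) -> atomic_set nu (\bigcup_i E i).
Proof.
move=> nuP aE; have bE i : borel (E i) by have [] := aE i.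
split=> [|F bF FE nF]; first exact: borel_bigcup.
have [i ni] : exists i, nu (F `&` E i) <> 0.
  apply: contrapT => /forallNP E0; apply: nF.
  rewrite -(setIidl FE) setI_bigcupr; apply: povm_bigcup_null => // i.
    exact: borelI.
  by apply: contrapT; exact: E0.
have [A AFE atA] := (aE i).2 _ (borelI bF (bE i)) (@subIsetr _ _ _) ni.
by exists A => // x /AFE[].
Qed.

(** The atomic part is the restriction of [nu] to an exhausting atomic set M;
    every atom of [nu] is an atomic set, so none can avoid M. *)
Lemma povm_atomic_decomposition nu : separable H -> is_povm nu ->
  exists nua nuna, atomic_decomposition nu nua nuna.
Proof.
move=> sH nuP.
have [||E aE|M [bM aM] maxM] := @povm_exhaustion _ _ _ _ nuP (atomic_set nu) sH.
- split; first exact: borel0.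
  by move=> F _; rewrite subset0 => ->; rewrite povm0.
- by move=> E [].
- exact: atomic_set_bigcup.
have bM' := borelC bM.
exists (fun E => nu (E `&` M)), (fun E => nu (E `&` ~` M)); split.
- split; first exact: povm_restrict.
  move=> E bE nE; have [A AEM atA] := aM _ (borelI bE bM) (@subIsetr _ _ _) nE.
  exists A => [x /AEM[]//|]; apply: eq_atom atA => B _ BA.
  by rewrite setIidl // => x /BA/AEM[].
- split; first exact: povm_restrict.
  move=> A /(atom_restrict bM') atAM; have [bAM nAM _] := atAM; apply: nAM.
  have := maxM (A `&` ~` M); rewrite setDE -setIA setIid; apply.
  split=> // F bF FAM nF; exists F => //; exact: atom_sub atAM _ _ _.
- by move=> E bE; rewrite (povmID nuP bE bM) setDE.
Qed.

(** C is A minus an exhausting mu-null subset of A with respect to [nu]. If C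
    were not nu-null it would be an atom of [nu]: for B inside C, one of B and
    C minus B is mu-null because A is an atom of [mu], hence nu-null by
    exhaustion. *)
Lemma atom_null_subset mu nu A : separable H -> is_povm mu -> is_povm nu ->
  is_atom mu A -> non_atomic nu ->
  exists C, [/\ borel C, C `<=` A, nu C = 0 & mu C <> 0].
Proof.
move=> sH muP nuP [bA nA atA] nuna.
pose P B := [/\ borel B, B `<=` A & mu B = 0].
have [||E PE|M [bM MA M0] maxM] := @povm_exhaustion _ _ _ _ nuP P sH.
- by split; [exact: borel0|by []|exact: povm0].
- by move=> B [].
- split; first by apply: borel_bigcup => i; have [] := PE i.
    by apply: bigcup_sub => i _; have [] := PE i.
  by apply: povm_bigcup_null => // i; have [] := PE i.
have bC : borel (A `\` M) by exact: borelD.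
have muC : mu (A `\` M) = mu A.
  by rewrite [RHS](povmID muP bA bM) setIidr // M0 add0r.
exists (A `\` M); split=> //; last by rewrite muC.
apply: contrapT => nC; apply: (nuna (A `\` M)); split=> // B bB BC.
have BA : B `<=` A by move=> x /BC[].
have BM : B `\` M = B by rewrite setDE; apply/setIidl => x /BC[].
have [B0|Bfull] := atA B bB BA.
  by left; rewrite -BM; apply: maxM.
right; apply/(povm_eq_diff_null nuP) => //.
have D0 : mu ((A `\` M) `\` B) = 0.
  by apply/(povm_eq_diff_null muP) => //; rewrite muC.
have <- : ((A `\` M) `\` B) `\` M = (A `\` M) `\` B.
  by rewrite setDE; apply/setIidl => x [[]].
apply: maxM; split=> //; first exact: borelD.
by move=> x [[]].
Qed.

(** S is an exhausting nu-null set with respect to [mu]. Were its complement not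
    mu-null, it would contain an atom of [mu], hence a nu-null set that is not
    mu-null and misses S. *)
Lemma atomic_non_atomic_singular mu nu : separable H -> is_povm mu -> is_povm nu ->
  atomic mu -> non_atomic nu ->
  exists S, [/\ borel S, nu S = 0 & mu (~` S) = 0].
Proof.
move=> sH muP nuP mua nuna; pose P S := borel S /\ nu S = 0.
have [||E PE|S [bS S0] maxS] := @povm_exhaustion _ _ _ _ muP P sH.
- by split; [exact: borel0|exact: povm0].
- by move=> B [].
- split; first by apply: borel_bigcup => i; have [] := PE i.
  by apply: povm_bigcup_null => // i; have [] := PE i.
exists S; split=> //; apply: contrapT => nS.
have [A AS atA] := mua _ (borelC bS) nS.
have [C [bC CA C0 nC]] := atom_null_subset sH muP nuP atA nuna.
apply: nC; have <- : C `\` S = C by rewrite setDE; apply/setIidl => x /CA/AS.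
exact: maxS.
Qed.

Lemma decomposition_restrict nu mua muna : separable H ->
  atomic_decomposition nu mua muna ->
  exists S, [/\ borel S, muna S = 0, mua (~` S) = 0 &
    forall E, borel E -> mua E = nu (E `&` S)].
Proof.
move=> sH [[aP aa] [nP na] nuE].
have [S [bS nS aS]] := atomic_non_atomic_singular sH aP nP aa na.
exists S; split=> // E bE; rewrite nuE; last exact: borelI.
have aD : mua (E `\` S) = 0.
  by apply: (povm_sub_null aP (borelC bS)) => //; exact: borelD.
have nI : muna (E `&` S) = 0.
  by apply: (povm_sub_null nP bS) => //; exact: borelI.
by rewrite (povmID aP bE bS) aD nI.
Qed.

(** On S, [nu] coincides with the atomic part of one decomposition and with the
    non-atomic part of the other: an atom of the former inside S would be an
    atom of the latter. *)
Lemma null_mixed nu mua muna mua' muna' S : is_povm nu ->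
  atomic_decomposition nu mua muna -> atomic_decomposition nu mua' muna' ->
  borel S -> muna S = 0 -> mua' S = 0 -> nu S = 0.
Proof.
move=> nuP [[aP aa] [nP _] nuE] [[aP' _] [nP' na'] nuE'] bS nS aS.
apply: contrapT => nuS.
have eqa B : borel B -> B `<=` S -> mua B = nu B.
  by move=> bB BS; rewrite nuE // (povm_sub_null nP bS) // addr0.
have eqn B : borel B -> B `<=` S -> nu B = muna' B.
  by move=> bB BS; rewrite nuE' // (povm_sub_null aP' bS) // add0r.
have [|A AS atA] := aa S bS; first by rewrite eqa.
apply: (na' A); apply: eq_atom atA => B bB BA.
have BS := subset_trans BA AS; by rewrite eqa // eqn.
Qed.

Lemma atomic_part_unique nu mua muna mua' muna' : separable H -> is_povm nu ->
  atomic_decomposition nu mua muna -> atomic_decomposition nu mua' muna' ->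
  eq_on_borel mua mua'.
Proof.
move=> sH nuP d d' E bE.
have [S [bS nS aS aE]] := decomposition_restrict sH d.
have [S' [bS' nS' aS' aE']] := decomposition_restrict sH d'.
have nuD : nu (S `\` S') = 0.
  have bD := borelD bS bS'.
  apply: (null_mixed nuP d d' bD).
    have [_ [nP _] _] := d; exact: (povm_sub_null nP bS).
  by have [[aP' _] _ _] := d'; apply: (povm_sub_null aP' (borelC bS') bD _ aS') => x [].
have nuD' : nu (S' `\` S) = 0.
  have bD := borelD bS' bS.
  apply: (null_mixed nuP d' d bD).
    have [_ [nP _] _] := d'; exact: (povm_sub_null nP bS').
  by have [[aP _] _ _] := d; apply: (povm_sub_null aP (borelC bS) bD _ aS) => x [].
have null_part A B : borel A -> borel B -> nu (A `\` B) = 0 ->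
    nu (E `&` A) = nu (E `&` A `&` B).
  move=> bA bB AB0; have bEA := borelI bE bA.
  have D0 : nu ((E `&` A) `\` B) = 0.
    apply: (povm_sub_null nuP (borelD bA bB) (borelD bEA bB) _ AB0).
    by apply: setSD; exact: subIsetr.
  by rewrite (povmID nuP bEA bB) D0 addr0.
by rewrite aE // aE' // (null_part S S') // (null_part S' S) // setIAC.
Qed.

End Atoms.

Theorem theorem3p10 (R : realType) (X : topologicalType) (H : hilbertSpace R)
    (X_hausdorff : hausdorff_space X)
    (X_locally_compact : locally_compact [set: X])
    (H_separable : separable H)
    (nu : set X -> boundedOp H) (nu_povm : is_povm nu) :
  (exists nua nuna : set X -> boundedOp H, atomic_decomposition nu nua nuna) /\
  (forall nua nuna nua' nuna' : set X -> boundedOp H,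
     atomic_decomposition nu nua nuna -> atomic_decomposition nu nua' nuna' ->
     eq_on_borel nua nua' /\ eq_on_borel nuna nuna').
Proof.
split; first exact: povm_atomic_decomposition.
move=> nua nuna nua' nuna' d d'.
have eqa := atomic_part_unique H_separable nu_povm d d'.
split=> // E bE; have [_ _ nuE] := d; have [_ _ nuE'] := d'.
by apply: (GRing.addrI (nua E)); rewrite -nuE // eqa // -nuE'.
Qed.
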